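(* Let $(\mathscr C,A,\psi)$ be an entwining structure. Then the forgetful functor $G_\psi:Com^{\mathscr C}_A(\psi)\to Com^{\mathscr C}$ is separable if and only if there exists $\lambda\in W_1$ such that $\lambda^{X1}(f)\lambda^{X2}(f)=\epsilon_X(f)\cdot1\in A$ for all $f\in\mathscr C(X,X)$ and all $X\in Ob(\mathscr C)$.
   Context: $K$ is a field. A $K$-coalgebra with several objects $\mathscr C$: a set $Ob(\mathscr C)$, vector spaces $\mathscr C(X,Y)$, linear comultiplications $\delta_{XYZ}:\mathscr C(X,Z)\to\mathscr C(Y,Z)\otimes\mathscr C(X,Y)$, $\delta_{XYZ}(f)=f_{Y1}\otimes f_{Y2}$, and counits $\epsilon_X$, with $(\delta_{YWZ}\otimes\mathrm{id})\delta_{XYZ}=(\mathrm{id}\otimes\delta_{XYW})\delta_{XWZ}$ and $(\epsilon_Y\otimes\mathrm{id})\delta_{XYY}=\mathrm{id}=(\mathrm{id}\otimes\epsilon_X)\delta_{XXY}$. For a $K$-algebra $A$ (multiplication $\mu_A$), an entwining structure $(\mathscr C,A,\psi)$ is a family of linear maps $\psi_{XY}:\mathscr C(X,Y)\otimes A\to A\otimes\mathscr C(X,Y)$, $\psi_{XY}(f\otimes a)=a_\psi\otimes f^\psi$, with (i) $(\mathrm{id}_A\otimes\delta_{XYZ})\psi_{XZ}=(\psi_{YZ}\otimes\mathrm{id})(\mathrm{id}\otimes\psi_{XY})(\delta_{XYZ}\otimes\mathrm{id}_A)$; (ii) $\psi_{XZ}(\mathrm{id}\otimes\mu_A)=(\mu_A\otimes\mathrm{id})(\mathrm{id}_A\otimes\psi_{XZ})(\psi_{XZ}\otimes\mathrm{id}_A)$;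 (iii) $\psi_{XZ}(f\otimes1)=1\otimes f$; (iv) $\epsilon_Z(g^\psi)a_\psi=\epsilon_Z(g)a$. $Com^{\mathscr C}$: right $\mathscr C$-comodules (spaces $\mathcal M(X)$, coactions $\rho_{XY}(m)=m_{Y0}\otimes m_{Y1}$ with $(\rho_{ZY}\otimes\mathrm{id})\rho_{XZ}=(\mathrm{id}\otimes\delta_{XZY})\rho_{XY}$, $(\mathrm{id}\otimes\epsilon_X)\rho_{XX}=\mathrm{id}$) with coaction-compatible morphisms. $Com^{\mathscr C}_A(\psi)$: entwined comodules (comodules with right $A$-module structures on each $\mathcal M(X)$ such that $\rho_{XY}(ma)=m_{Y0}a_\psi\otimes(m_{Y1})^\psi$) with $A$-linear comodule morphisms; $G_\psi$ forgets the $A$-actions. $W_1$ is the space of families $\lambda=\{\lambda^X:\mathscr C(X,X)\to A\otimes A\}_X$, $\lambda^X(f)=\lambda^{X1}(f)\otimes\lambda^{X2}(f)$ (summation suppressed), such that for all $f\in\mathscr C(X,Y)$: $\lambda^{Y1}(f_{Y1})\otimes\lambda^{Y2}(f_{Y1})\otimes f_{Y2}=(\mathrm{id}_A\otimes\psi_{XY})(\psi_{XY}\otimes\mathrm{id}_A)(f_{X1}\otimes\lambda^X(f_{X2}))$, and for all $g\in\mathscr C(Z,Z)$, $a\in A$: $\lambda^{Z1}(g)\otimes\lambda^{Z2}(g)a=a_\psi\lambda^{Z1}(g^\psi)\otimes\lambda^{Z2}(g^\psi)$ with $a_\psi\otimes g^\psi=\psi_{ZZ}(g\otimes a)$. A functor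 $F:\mathcal D\to\mathcal D'$ is separable if the natural transformation $\mathcal D(-,-)\to\mathcal D'(F-,F-)$, $\phi\mapsto F(\phi)$, has a natural left inverse. *)

(* Defs.v *)
(* Coalgebras with several objects, entwining structures,
   entwined comodules and separability of the forgetful functor.
   Tensor products of K-vector spaces are represented by finite formal sums of
   pure tensors (Sweedler lists  seq (U * V)), two formal sums being equal in
   U (x) V iff they agree under every bilinear map into every K-vector space
   (i.e. the universal property of the tensor product). *)
From HB Require Import structures.
From mathcomp Require Import all_boot all_order all_algebra.
Set Implicit Arguments. Unset Strict Implicit. Unset Printing Implicit Defensive.
Import GRing.Theory.
Local Open Scope ring_scope.

Section Tensors.
Variable K : fieldType.

Definition is_bilin (U V W : lmodType K) (b : U -> V -> W) : Prop :=
  (forall (c : K) u1 u2 v, b (c *: u1 + u2) v = c *: b u1 v + b u2 v) /\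
  (forall (c : K) u v1 v2, b u (c *: v1 + v2) = c *: b u v1 + b u v2).

Definition is_trilin (U V T W : lmodType K) (b : U -> V -> T -> W) : Prop :=
  [/\ (forall (c : K) u1 u2 v t, b (c *: u1 + u2) v t = c *: b u1 v t + b u2 v t),
      (forall (c : K) u v1 v2 t, b u (c *: v1 + v2) t = c *: b u v1 t + b u v2 t)
    & (forall (c : K) u v t1 t2, b u v (c *: t1 + t2) = c *: b u v t1 + b u v t2)].

Definition teq2 (U V : lmodType K) (s t : seq (U * V)) : Prop :=
  forall (W : lmodType K) (b : U -> V -> W), is_bilin b ->
    \sum_(p <- s) b p.1 p.2 = \sum_(p <- t) b p.1 p.2.

Definition teq3 (U V T : lmodType K) (s t : seq (U * V * T)) : Prop :=
  forall (W : lmodType K) (b : U -> V -> T -> W), is_trilin b ->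
    \sum_(p <- s) b p.1.1 p.1.2 p.2 = \sum_(p <- t) b p.1.1 p.1.2 p.2.

Definition tscale2 (U V : lmodType K) (c : K) (s : seq (U * V)) : seq (U * V) :=
  [seq (c *: p.1, p.2) | p <- s].

Definition linear_to2 (T U V : lmodType K) (f : T -> seq (U * V)) : Prop :=
  forall (c : K) x y, teq2 (f (c *: x + y)) (tscale2 c (f x) ++ f y).

Definition is_linmap (U V : lmodType K) (f : U -> V) : Prop :=
  forall (c : K) x y, f (c *: x + y) = c *: f x + f y.

End Tensors.

Section Coalgebra.
Local Unset Implicit Arguments.
Variables (K : fieldType) (Ob : Type) (C : Ob -> Ob -> lmodType K)
  (delta : forall X Y Z : Ob, C X Z -> seq (C Y Z * C X Y))
  (eps : forall X : Ob, C X X -> K).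
Arguments eps {X}.
Local Set Implicit Arguments.

Definition is_coalgebra_so : Prop :=
  [/\ (forall X Y Z, linear_to2 (delta X Y Z)),
      (forall X (c : K) (f g : C X X), eps (c *: f + g) = c * eps f + eps g),
      (forall X Y W Z (f : C X Z),
         teq3 [seq (q.1, q.2, p.2) | p <- delta X Y Z f, q <- delta Y W Z p.1]
              [seq (p.1, q.1, q.2) | p <- delta X W Z f, q <- delta X Y W p.2]),
      (forall X Y (f : C X Y), \sum_(p <- delta X Y Y f) eps p.1 *: p.2 = f)
    & (forall X Y (f : C X Y), \sum_(p <- delta X X Y f) eps p.2 *: p.1 = f)].

Local Unset Implicit Arguments.
Variables (A : algType K) (psi : forall X Y : Ob, C X Y -> A -> seq (A * C X Y)).
Arguments psi {X Y}.
Local Set Implicit Arguments.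

Definition is_entwining : Prop :=
  [/\ (forall X Y (c : K) (f g : C X Y) (a : A),
         teq2 (psi (c *: f + g) a) (tscale2 c (psi f a) ++ psi g a)) /\
      (forall X Y (c : K) (f : C X Y) (a b : A),
         teq2 (psi f (c *: a + b)) (tscale2 c (psi f a) ++ psi f b)),
      (forall X Y Z (f : C X Z) (a : A),
         teq3 [seq (q.1, r.1, r.2) | q <- psi f a, r <- delta X Y Z q.2]
              (flatten [seq [seq (s.1, s.2, r.2) | r <- psi p.2 a, s <- psi p.1 r.1]
                        | p <- delta X Y Z f])),
      (forall X Z (f : C X Z) (a b : A),
         teq2 (psi f (a * b)) [seq (q.1 * r.1, r.2) | q <- psi f a, r <- psi q.2 b]),
      (forall X Z (f : C X Z), teq2 (psi f 1) [:: (1, f)])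
    &
      (forall Z (g : C Z Z) (a : A),
         \sum_(p <- psi g a) eps p.2 *: p.1 = eps g *: a)].

Definition is_comodule (M : Ob -> lmodType K)
    (rho : forall X Y : Ob, M X -> seq (M Y * C X Y)) : Prop :=
  [/\ (forall X Y, linear_to2 (rho X Y)),
      (forall X Y Z (m : M X),
         teq3 [seq (q.1, q.2, p.2) | p <- rho X Z m, q <- rho Z Y p.1]
              [seq (p.1, q.1, q.2) | p <- rho X Y m, q <- delta X Z Y p.2])
    & (forall X (m : M X), \sum_(p <- rho X X m) eps p.2 *: p.1 = m)].

Record comodule := Comodule {
  cm_sp : Ob -> lmodType K;
  cm_rho : forall X Y : Ob, cm_sp X -> seq (cm_sp Y * C X Y);
  cm_ax : is_comodule cm_rho }.

Definition is_entwined (M : comodule) (act : forall X, cm_sp M X -> A -> cm_sp M X) : Prop :=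
  [/\ (forall X (c : K) (m m' : cm_sp M X) (a : A),
         act X (c *: m + m') a = c *: act X m a + act X m' a),
      (forall X (c : K) (m : cm_sp M X) (a b : A),
         act X m (c *: a + b) = c *: act X m a + act X m b),
      (forall X (m : cm_sp M X) (a b : A), act X m (a * b) = act X (act X m a) b),
      (forall X (m : cm_sp M X), act X m 1 = m)
    & (forall X Y (m : cm_sp M X) (a : A),
         teq2 (@cm_rho M X Y (act X m a))
              [seq (act Y p.1 q.1, q.2) | p <- @cm_rho M X Y m, q <- psi p.2 a])].

Record entwined := Entwined {
  ec_com : comodule;
  ec_act : forall X, cm_sp ec_com X -> A -> cm_sp ec_com X;
  ec_ax : is_entwined ec_act }.

Definition is_comhom (M N : comodule) (f : forall X, cm_sp M X -> cm_sp N X) : Prop :=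
  (forall X, is_linmap (f X)) /\
  (forall X Y (m : cm_sp M X),
     teq2 (@cm_rho N X Y (f X m)) [seq (f Y p.1, p.2) | p <- @cm_rho M X Y m]).

Definition comhom (M N : comodule) :=
  {f : forall X, cm_sp M X -> cm_sp N X | is_comhom f}.

Definition ecomhom (M N : entwined) :=
  {f : forall X, cm_sp (ec_com M) X -> cm_sp (ec_com N) X |
     is_comhom f /\ (forall X m a, f X (ec_act m a) = ec_act (f X m) a)}.

Definition G_mor (M N : entwined) (phi : ecomhom M N) : comhom (ec_com M) (ec_com N) :=
  exist _ (sval phi) (proj1 (svalP phi)).

Definition G_separable : Prop :=
  exists P : forall M N : entwined, comhom (ec_com M) (ec_com N) -> ecomhom M N,
    (forall M N (phi : ecomhom M N) X m, sval (P M N (G_mor phi)) X m = sval phi X m) /\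
    (forall M M' N N' (al : ecomhom M' M) (be : ecomhom N N')
            (g : comhom (ec_com M) (ec_com N)) (g' : comhom (ec_com M') (ec_com N')),
       (forall X m, sval g' X m = sval be X (sval g X (sval al X m))) ->
       forall X m, sval (P M' N' g') X m = sval be X (sval (P M N g) X (sval al X m))).

Definition in_W1 (lam : forall X : Ob, C X X -> seq (A * A)) : Prop :=
  [/\ (forall X, linear_to2 (lam X)),
      (forall X Y (f : C X Y),
         teq3 [seq (q.1, q.2, p.2) | p <- delta X Y Y f, q <- lam Y p.1]
              (flatten [seq flatten [seq [seq (r.1, s.1, s.2) | r <- psi p.1 q.1,
                                                              s <- psi r.2 q.2]
                                        | q <- lam X p.2]
                        | p <- delta X X Y f]))
    & (forall Z (g : C Z Z) (a : A),
         teq2 [seq (q.1, q.2 * a) | q <- lam Z g]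
              [seq (r.1 * q.1, q.2) | r <- psi g a, q <- lam Z r.2])].

End Coalgebra.

(* Main.v *)
(** If lam lies in W_1 and is normalized, a comodule map g : M -> N between
    entwined comodules is averaged to m |-> g(m_0 lam1(m_1)) lam2(m_1), which is
    A-linear and colinear, and equals g when g is already A-linear.

    Conversely, the forgetful functor has the left adjoint M |-> M (x) A.  Applying
    the natural retraction to the unit M -> M (x) A of every entwined M gives a
    natural section nu of the counit M (x) A -> M.  Put
    lam^Z(f) = (id (x) eps_Z (x) id) (nu (1 (x) f)), with nu taken at A (x) C(-,Z).
    For an A-module N the comodule N (x) C(-,Z) is entwined.  Naturality of nu
    along n * - : A -> N and along the coaction M -> M(X) (x) C(-,X) gives
    nu(m) = m_0 lam1(m_1) (x) lam2(m_1) for all M and m in M(X).  The two conditions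
    defining W_1 then say that nu is colinear and A-linear on 1 (x) f. *)
Require Import Defs.
From HB Require Import structures.
From mathcomp Require Import all_boot all_order all_algebra.
From mathcomp Require Import boolp.
Set Implicit Arguments. Unset Strict Implicit. Unset Printing Implicit Defensive.
Import GRing.Theory.
Local Open Scope ring_scope.

(** * Sweedler sums and linearity *)

Section Linearity.
Variable K : fieldType.
Implicit Types T U V W : lmodType K.

Lemma linmap0 T W (f : T -> W) : is_linmap f -> f 0 = 0.
Proof. by move=> /(_ (-1) 0 0); rewrite scaler0 addr0 scaleN1r addNr. Qed.

Lemma linmap_scale T W (f : T -> W) c x : is_linmap f -> f (c *: x) = c *: f x.
Proof. by move=> fl; rewrite -[c *: x]addr0 fl (linmap0 fl) addr0. Qed.

Lemma linmap_sum T W (f : T -> W) (I : Type) (s : seq I) (G : I -> T) :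
  is_linmap f -> f (\sum_(i <- s) G i) = \sum_(i <- s) f (G i).
Proof.
move=> fl; elim: s => [|i s IHs]; first by rewrite !big_nil (linmap0 fl).
by rewrite !big_cons -IHs -[G i]scale1r fl !scale1r.
Qed.

Lemma sum_cat (W : zmodType) (I : Type) (s t : seq I) (F : I -> W) :
  \sum_(i <- s ++ t) F i = \sum_(i <- s) F i + \sum_(i <- t) F i.
Proof. exact: big_cat. Qed.

Lemma lin_id T : is_linmap (fun x : T => x). Proof. by []. Qed.

Lemma lin_comp T U W (f : U -> W) (h : T -> U) :
  is_linmap f -> is_linmap h -> is_linmap (fun x => f (h x)).
Proof. by move=> fl hl c x y; rewrite hl fl. Qed.

Lemma lin_sum T W (I : Type) (s : seq I) (F : I -> T -> W) :
  (forall i, is_linmap (F i)) -> is_linmap (fun x => \sum_(i <- s) F i x).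
Proof.
move=> Fl c x y; rewrite scaler_sumr -big_split /=.
by apply: eq_bigr => i _; apply: Fl.
Qed.

Lemma lin_scale T W (c : K) (h : T -> W) :
  is_linmap h -> is_linmap (fun x => c *: h x).
Proof. by move=> hl d x y; rewrite hl scalerDr !scalerA mulrC. Qed.

Lemma lin_coef T W (w : W) (h : T -> K) :
  (forall c x y, h (c *: x + y) = c * h x + h y) ->
  is_linmap (fun x => h x *: w).
Proof. by move=> hl d x y; rewrite hl scalerDl scalerA. Qed.

Lemma lin_mull T (A : algType K) (a : A) (h : T -> A) :
  is_linmap h -> is_linmap (fun x => a * h x).
Proof. by move=> hl d x y; rewrite hl mulrDr scalerAr. Qed.

Lemma lin_mulr T (A : algType K) (a : A) (h : T -> A) :
  is_linmap h -> is_linmap (fun x => h x * a).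
Proof. by move=> hl d x y; rewrite hl mulrDl scalerAl. Qed.

(** The test map takes a pair and its bilinearity is split into two [is_linmap] conditions. In this
    form [F] can be read off from a Sweedler sum, and the side conditions are of the kind that [lin]
    solves. *)
Lemma teq2_sum U V W (s t : seq (U * V)) (F : U * V -> W) :
  teq2 s t ->
  (forall v, is_linmap (fun u => F (u, v))) ->
  (forall u, is_linmap (fun v => F (u, v))) ->
  \sum_(p <- s) F p = \sum_(p <- t) F p.
Proof.
move=> st Fl Fr.
have /st E : is_bilin (fun u v => F (u, v)).
  by split=> [c u1 u2 v | c u v1 v2]; [apply: Fl | apply: Fr].
rewrite (eq_bigr (fun p => F (p.1, p.2))) => [|[]//].
by rewrite E; apply: eq_bigr => -[].
Qed.

Lemma teq3_sum U V T W (s t : seq (U * V * T)) (F : U * V * T -> W) :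
  teq3 s t ->
  (forall v x, is_linmap (fun u => F (u, v, x))) ->
  (forall u x, is_linmap (fun v => F (u, v, x))) ->
  (forall u v, is_linmap (fun x => F (u, v, x))) ->
  \sum_(p <- s) F p = \sum_(p <- t) F p.
Proof.
move=> st F1 F2 F3.
have /st E : is_trilin (fun u v x => F (u, v, x)).
  by split=> *; [apply: F1 | apply: F2 | apply: F3].
rewrite (eq_bigr (fun p => F (p.1.1, p.1.2, p.2))) => [|[[]]//].
by rewrite E; apply: eq_bigr => -[[]].
Qed.

Lemma teq2P U V (s t : seq (U * V)) :
  (forall W (F : U * V -> W),
     (forall v, is_linmap (fun u => F (u, v))) ->
     (forall u, is_linmap (fun v => F (u, v))) ->
     \sum_(p <- s) F p = \sum_(p <- t) F p) -> teq2 s t.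
Proof.
move=> H W b [bl br].
by apply: (H W (fun p => b p.1 p.2)) => [v|u] c x y; [exact: bl | exact: br].
Qed.

Lemma teq3P U V T (s t : seq (U * V * T)) :
  (forall W (F : U * V * T -> W),
     (forall v x, is_linmap (fun u => F (u, v, x))) ->
     (forall u x, is_linmap (fun v => F (u, v, x))) ->
     (forall u v, is_linmap (fun x => F (u, v, x))) ->
     \sum_(p <- s) F p = \sum_(p <- t) F p) -> teq3 s t.
Proof.
move=> H W b [b1 b2 b3].
by apply: (H W (fun p => b p.1.1 p.1.2 p.2)) => *; move=> c x y;
  [exact: b1 | exact: b2 | exact: b3].
Qed.

Lemma sum_tscale2 U V W (F : U * V -> W) c s :
  (forall v, is_linmap (fun u => F (u, v))) ->
  \sum_(p <- tscale2 c s) F p = c *: \sum_(p <- s) F p.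
Proof.
move=> Fl; rewrite big_map scaler_sumr; apply: eq_bigr => -[u v] _ /=.
exact: (linmap_scale (f := fun u => F (u, v))).
Qed.

(** Tensors are compared through bilinear test maps alone, so linearity into a tensor product may be
    checked after composing with each of them. *)
Lemma linear_to2P T U V (f : T -> seq (U * V)) :
  (forall W (F : U * V -> W),
     (forall v, is_linmap (fun u => F (u, v))) ->
     (forall u, is_linmap (fun v => F (u, v))) ->
     is_linmap (fun x => \sum_(p <- f x) F p)) ->
  linear_to2 f.
Proof. by move=> H c x y; apply: teq2P => W F Fl Fr; rewrite H // sum_cat sum_tscale2. Qed.

Lemma lin_sum_to2 T T' U V W (f : T -> seq (U * V)) (h : T' -> T) (F : U * V -> W) :
  linear_to2 f -> is_linmap h ->
  (forall v, is_linmap (fun u => F (u, v))) ->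
  (forall u, is_linmap (fun v => F (u, v))) ->
  is_linmap (fun x => \sum_(p <- f (h x)) F p).
Proof.
by move=> fl hl Fl Fr c x y; rewrite hl (teq2_sum (fl _ _ _)) // sum_cat sum_tscale2.
Qed.

End Linearity.

(** * The tensor product as a quotient of formal sums *)

Section TensorProduct.
Variables (K : fieldType) (U V : lmodType K).

(** The quotient requires a boolean relation, while [teq2] quantifies over all target spaces; its
    truth value is therefore taken classically. *)
Definition teq2b (s t : seq (U * V)) : bool := `[< teq2 s t >].

Lemma teq2b_refl : reflexive teq2b. Proof. by move=> s; apply/asboolP. Qed.
Lemma teq2b_sym : symmetric teq2b.
Proof. by move=> s t; apply/asboolP/asboolP => st W b /st. Qed.
Lemma teq2b_trans : transitive teq2b.
Proof.
move=> t s r /asboolP st /asboolP tr; apply/asboolP => W b bl.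
by rewrite (st _ _ bl) tr.
Qed.

Definition teq2_equiv := EquivRel teq2b teq2b_refl teq2b_sym teq2b_trans.

Local Open Scope quotient_scope.

(** The components of a comodule must be vector spaces, which lists of pairs are not. The free and
    cofree comodules below are built on this quotient. *)
Definition tens := {eq_quot teq2_equiv}.
HB.instance Definition _ := Choice.on tens.

Definition tcls (s : seq (U * V)) : tens := \pi_tens s.
Definition trep (x : tens) : seq (U * V) := repr x.

Lemma trepK x : tcls (trep x) = x. Proof. exact: reprK. Qed.

Lemma tclsK s : teq2 (trep (tcls s)) s.
Proof. by have /eqmodP/asboolP := reprK (tcls s). Qed.

Lemma tcls_eq s t : teq2 s t -> tcls s = tcls t.
Proof. by move=> st; apply/eqmodP/asboolP. Qed.

Definition tadd (x y : tens) := tcls (trep x ++ trep y).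
Definition topp (x : tens) := tcls (tscale2 (-1) (trep x)).
Definition tscale (c : K) (x : tens) := tcls (tscale2 c (trep x)).

Let sumE (W : lmodType K) (F : U * V -> W)
  (Fl : forall v, is_linmap (fun u => F (u, v)))
  (Fr : forall u, is_linmap (fun v => F (u, v))) :=
  ((fun s => teq2_sum (tclsK s) Fl Fr), (fun c s => sum_tscale2 c s Fl),
   (fun s t => sum_cat s t F)).

(** Each vector space axiom becomes an identity between values of a bilinear map, once the
    right-hand side is written as the class of its representative. *)
Ltac tens_ax := rewrite /tadd /topp /tscale;
  try rewrite -[RHS]trepK; apply/tcls_eq/teq2P.

Lemma taddA : associative tadd.
Proof. by move=> x y z; tens_ax => W F Fl Fr; rewrite !(sumE Fl Fr) addrA. Qed.
Lemma taddC : commutative tadd.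
Proof. by move=> x y; tens_ax => W F Fl Fr; rewrite !(sumE Fl Fr) addrC. Qed.
Lemma tadd0 : left_id (tcls [::]) tadd.
Proof. by move=> x; tens_ax => W F Fl Fr; rewrite !(sumE Fl Fr) big_nil add0r. Qed.
Lemma taddN : left_inverse (tcls [::]) topp tadd.
Proof. by move=> x; tens_ax => W F Fl Fr; rewrite !(sumE Fl Fr) big_nil scaleN1r addNr. Qed.

HB.instance Definition _ := GRing.isZmodule.Build tens taddA taddC tadd0 taddN.

Lemma tscaleA a b x : tscale a (tscale b x) = tscale (a * b) x.
Proof. by tens_ax => W F Fl Fr; rewrite !(sumE Fl Fr) scalerA. Qed.
Lemma tscale1 : left_id 1 tscale.
Proof. by move=> x; tens_ax => W F Fl Fr; rewrite !(sumE Fl Fr) scale1r. Qed.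
Lemma tscaleDr : right_distributive tscale +%R.
Proof. by move=> c x y; tens_ax => W F Fl Fr; rewrite !(sumE Fl Fr) scalerDr. Qed.
Lemma tscaleDl x : {morph tscale^~ x : a b / a + b}.
Proof. by move=> a b; tens_ax => W F Fl Fr; rewrite !(sumE Fl Fr) scalerDl. Qed.

HB.instance Definition _ :=
  GRing.Zmodule_isLmodule.Build K tens tscaleA tscale1 tscaleDr tscaleDl.

(** Chosen representatives are additive only up to [teq2], which suffices for sums over [trep] with
    bilinear summands. *)
Lemma trep_linear : linear_to2 (trep : tens -> seq (U * V)).
Proof.
apply: linear_to2P => W F Fl Fr c x y.
rewrite (teq2_sum (tclsK _) Fl Fr) sum_cat; congr (_ + _).
by rewrite (teq2_sum (tclsK _) Fl Fr) sum_tscale2.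
Qed.

Lemma trep_inj x y : teq2 (trep x) (trep y) -> x = y.
Proof. by move=> /tcls_eq; rewrite !trepK. Qed.

End TensorProduct.

(** * Pure tensors and evaluation of sums over representatives *)

Section PureTensors.
Variables (K : fieldType) (U V : lmodType K).

Definition tpure (u : U) (v : V) : tens U V := tcls [:: (u, v)].

Lemma sum_pure (W : lmodType K) (F : U * V -> W) u v :
  (forall v, is_linmap (fun u => F (u, v))) ->
  (forall u, is_linmap (fun v => F (u, v))) ->
  \sum_(p <- trep (tpure u v)) F p = F (u, v).
Proof. by move=> Fl Fr; rewrite (teq2_sum (tclsK _) Fl Fr) big_seq1. Qed.

Lemma sum_trep_sum (W : lmodType K) (F : U * V -> W) I (s : seq I) (G : I -> tens U V) :
  (forall v, is_linmap (fun u => F (u, v))) ->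
  (forall u, is_linmap (fun v => F (u, v))) ->
  \sum_(p <- trep (\sum_(i <- s) G i)) F p = \sum_(i <- s) \sum_(p <- trep (G i)) F p.
Proof.
move=> Fl Fr; pose f x := \sum_(p <- trep x) F p.
have fl : is_linmap f by apply: (lin_sum_to2 (@trep_linear K U V) (h := id) _ Fl Fr) => c x y.
exact: (linmap_sum s G fl).
Qed.

Lemma lin_pure1 (T : lmodType K) (v : V) (h : T -> U) :
  is_linmap h -> is_linmap (fun x : T => tpure (h x) v).
Proof.
move=> hl c x y; rewrite hl; apply/trep_inj/teq2P => W F Fl Fr.
by rewrite sum_pure // (teq2_sum (trep_linear _ _ _)) // sum_cat sum_tscale2 // !sum_pure // Fl.
Qed.

Lemma lin_pure2 (T : lmodType K) (u : U) (h : T -> V) :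
  is_linmap h -> is_linmap (fun x : T => tpure u (h x)).
Proof.
move=> hl c x y; rewrite hl; apply/trep_inj/teq2P => W F Fl Fr.
by rewrite sum_pure // (teq2_sum (trep_linear _ _ _)) // sum_cat sum_tscale2 // !sum_pure // Fr.
Qed.

Lemma pure_scalel c u v : tpure (c *: u) v = c *: tpure u v.
Proof. exact: (linmap_scale c u (lin_pure1 v (@lin_id _ U))). Qed.

Lemma pure_scaler c u v : tpure u (c *: v) = c *: tpure u v.
Proof. exact: (linmap_scale c v (lin_pure2 u (@lin_id _ V))). Qed.

Lemma tens_sum (x : tens U V) : x = \sum_(p <- trep x) tpure p.1 p.2.
Proof.
apply/trep_inj/teq2P => W F Fl Fr; rewrite sum_trep_sum //.
by apply: eq_bigr => -[u v] _; rewrite sum_pure.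
Qed.

End PureTensors.

(** * Linearity of nested Sweedler sums, and its automation *)

Section MoreLinearity.
Variable K : fieldType.
Implicit Types T U V W : lmodType K.

Lemma sum_flatten (W : zmodType) I L (s : seq I) (t : I -> seq L) (F : L -> W) :
  \sum_(l <- flatten [seq t i | i <- s]) F l = \sum_(i <- s) \sum_(l <- t i) F l.
Proof. by rewrite big_flatten big_map. Qed.

Lemma lin_map T W I L (s : T -> seq I) (h : T -> I -> L) (F : T -> L -> W) :
  is_linmap (fun x => \sum_(p <- s x) F x (h x p)) ->
  is_linmap (fun x => \sum_(l <- [seq h x p | p <- s x]) F x l).
Proof. by move=> H c x y; rewrite !big_map H. Qed.

Lemma lin_flatten T W I L (s : T -> seq I) (t : T -> I -> seq L) (F : T -> L -> W) :
  is_linmap (fun x => \sum_(p <- s x) \sum_(l <- t x p) F x l) ->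
  is_linmap (fun x => \sum_(l <- flatten [seq t x p | p <- s x]) F x l).
Proof. by move=> H c x y; rewrite !sum_flatten H. Qed.

Lemma lin_pair1 T U V W (F : U * V -> W) :
  (forall v, is_linmap (fun u => F (u, v))) ->
  forall (h : T -> U) v, is_linmap h -> is_linmap (fun x => F (h x, v)).
Proof. by move=> Fl h v hl c x y; rewrite hl Fl. Qed.

Lemma lin_pair2 T U V W (F : U * V -> W) :
  (forall u, is_linmap (fun v => F (u, v))) ->
  forall (h : T -> V) u, is_linmap h -> is_linmap (fun x => F (u, h x)).
Proof. by move=> Fl h v hl c x y; rewrite hl Fl. Qed.

Lemma lin_triple1 T U V V' W (F : U * V * V' -> W) :
  (forall v v', is_linmap (fun u => F (u, v, v'))) ->
  forall (h : T -> U) v v', is_linmap h -> is_linmap (fun x => F (h x, v, v')).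
Proof. by move=> Fl h v v' hl c x y; rewrite hl Fl. Qed.

Lemma lin_triple2 T U V V' W (F : U * V * V' -> W) :
  (forall u v', is_linmap (fun v => F (u, v, v'))) ->
  forall (h : T -> V) u v', is_linmap h -> is_linmap (fun x => F (u, h x, v')).
Proof. by move=> Fl h v v' hl c x y; rewrite hl Fl. Qed.

Lemma lin_triple3 T U V V' W (F : U * V * V' -> W) :
  (forall u v, is_linmap (fun v' => F (u, v, v'))) ->
  forall (h : T -> V') u v, is_linmap h -> is_linmap (fun x => F (u, v, h x)).
Proof. by move=> Fl h v v' hl c x y; rewrite hl Fl. Qed.

End MoreLinearity.

Opaque tpure trep.

(* Rebound below to the linearity of the maps in scope. *)
Ltac lin_hook := fail.

(* [lin] treats a nested Sweedler sum in which the variable occurs exactly once. *)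
Ltac lin_step := lazymatch goal with
  | |- is_linmap (fun x => x) => exact: lin_id
  | |- is_linmap (fun x => tpure _ _) => first [apply: lin_pure1 | apply: lin_pure2]
  | |- is_linmap (fun x => _ *: _) => first [apply: lin_scale | lin_hook]
  | |- is_linmap (fun x => _ * _) => first [apply: lin_mull | apply: lin_mulr]
  | |- is_linmap (fun x => \sum_(i <- map _ _) _) => apply: lin_map
  | |- is_linmap (fun x => \sum_(i <- flatten _) _) => apply: lin_flatten
  | |- is_linmap (fun x => \sum_(i <- _) _) =>
       first [apply: lin_sum => ? | apply: (lin_sum_to2 (@trep_linear _ _ _)) | lin_hook]
  | |- is_linmap (fun x => ?F (_, _, _)) =>
        first [apply: (lin_triple1 (F := F)); [assumption|] | apply: (lin_triple2 (F := F)); [assumption|]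
             | apply: (lin_triple3 (F := F)); [assumption|]]
  | |- is_linmap (fun x => ?F (_, _)) =>
        first [apply: (lin_pair1 (F := F)); [assumption|] | apply: (lin_pair2 (F := F)); [assumption|]]
  | |- _ => first [assumption | lin_hook]
  end.

Ltac lin_eta := lazymatch goal with
  | |- is_linmap (fun x => _) => idtac
  | |- is_linmap ?f => change (is_linmap (fun x => f x))
  end.

Ltac lin := first [assumption | intros]; cbn [fst snd]; lin_eta; first [assumption | lin_step; lin].

(** * The map f (x) id on tensor products *)

Section MapLeft.
Variables (K : fieldType) (U U' V : lmodType K) (f : U -> U').
Hypothesis fl : is_linmap f.

Definition tmapl (t : tens U V) : tens U' V := \sum_(p <- trep t) tpure (f p.1) p.2.

Let lin_f (T : lmodType K) (h : T -> U) : is_linmap h -> is_linmap (fun x => f (h x)).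
Proof. exact: lin_comp. Qed.

Ltac lin_hook ::= apply: lin_f.

Lemma tmapl_lin : is_linmap tmapl.
Proof. by rewrite /tmapl; lin. Qed.

Lemma tmapl_pure u v : tmapl (tpure u v) = tpure (f u) v.
Proof. by rewrite /tmapl sum_pure; [|lin..]. Qed.

Lemma sum_tmapl (W : lmodType K) (F : U' * V -> W) t :
  (forall v, is_linmap (fun u => F (u, v))) ->
  (forall u, is_linmap (fun v => F (u, v))) ->
  \sum_(p <- trep (tmapl t)) F p = \sum_(p <- trep t) F (f p.1, p.2).
Proof.
move=> Fl Fr; rewrite /tmapl sum_trep_sum; [|lin..].
by apply: eq_bigr => p _; rewrite sum_pure; [|lin..].
Qed.

End MapLeft.

(* [norm] evaluates both sides as nested sums, removing [trep] of explicit tensors;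
   each removal is licensed by the bilinearity of the summand. *)
Ltac norm_step := lazymatch goal with
  | |- \sum_(i <- map _ _) _ = _ => rewrite big_map
  | |- \sum_(i <- flatten _) _ = _ => rewrite sum_flatten
  | |- \sum_(i <- [:: _]) _ = _ => rewrite big_seq1
  | |- \sum_(i <- trep (tpure _ _)) _ = _ => rewrite sum_pure; [|lin|lin]
  | |- \sum_(i <- trep (\sum_(j <- _) _)) _ = _ => rewrite sum_trep_sum; [|lin|lin]
  | |- \sum_(i <- trep (tmapl _ _)) _ = _ => rewrite sum_tmapl; [|lin|lin]
  | |- \sum_(i <- _) _ = _ => apply: eq_bigr => ? _
  end; cbn [fst snd].
Ltac norm_in := cbn [fst snd]; repeat norm_step; reflexivity.
Ltac norml := etransitivity; [norm_in|].
Ltac norm := norml; symmetry; norml; symmetry; cbv beta.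

(** * The coalgebra and entwining axioms as identities of sums *)

Section Setup.
Variables (K : fieldType) (Ob : Type) (C : Ob -> Ob -> lmodType K)
  (delta : forall X Y Z : Ob, C X Z -> seq (C Y Z * C X Y))
  (eps : forall X : Ob, C X X -> K)
  (HC : is_coalgebra_so delta eps)
  (A : algType K) (psi : forall X Y : Ob, C X Y -> A -> seq (A * C X Y))
  (Hpsi : is_entwining delta eps psi).

Let delta_lin X Y Z : linear_to2 (@delta X Y Z).
Proof. by case: HC. Qed.
Let eps_lin X c (f g : C X X) : eps (c *: f + g) = c * eps f + eps g.
Proof. by case: HC => _ H *; exact: H. Qed.
Let deltaA X Y W Z (f : C X Z) :
  teq3 [seq (q.1, q.2, p.2) | p <- delta Y f, q <- delta W p.1]
       [seq (p.1, q.1, q.2) | p <- delta W f, q <- delta Y p.2].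
Proof. by case: HC. Qed.
Let eps_delta1 X Y (f : C X Y) : \sum_(p <- delta Y f) eps p.1 *: p.2 = f.
Proof. by case: HC. Qed.
Let eps_delta2 X Y (f : C X Y) : \sum_(p <- delta X f) eps p.2 *: p.1 = f.
Proof. by case: HC. Qed.
Let psi_lin1 X Y a : linear_to2 (fun f => @psi X Y f a).
Proof. by case: Hpsi => -[H _] *; move=> c f g; exact: H. Qed.
Let psi_lin2 X Y f : linear_to2 (@psi X Y f).
Proof. by case: Hpsi => -[_ H] *; move=> c a b; exact: H. Qed.
Let psi_delta X Y Z (f : C X Z) a :
  teq3 [seq (q.1, r.1, r.2) | q <- psi f a, r <- delta Y q.2]
       (flatten [seq [seq (s.1, s.2, r.2) | r <- psi p.2 a, s <- psi p.1 r.1]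
                 | p <- delta Y f]).
Proof. by case: Hpsi. Qed.
Let psi_mul X Z (f : C X Z) a b :
  teq2 (psi f (a * b)) [seq (q.1 * r.1, r.2) | q <- psi f a, r <- psi q.2 b].
Proof. by case: Hpsi. Qed.
Let psi_one X Z (f : C X Z) : teq2 (psi f 1) [:: (1, f)].
Proof. by case: Hpsi. Qed.
Let psi_eps Z (g : C Z Z) a : \sum_(p <- psi g a) eps p.2 *: p.1 = eps g *: a.
Proof. by case: Hpsi. Qed.

Section Sums.
Variable W : lmodType K.

(** Coassociativity as a rewrite rule for Sweedler sums. The two composites of [delta] agree in the
    tensor product and not as lists, whence the trilinear summand. *)
Lemma deltaS X Y V Z (F : C Y Z * C V Y * C X V -> W) (f : C X Z) :
  (forall v x, is_linmap (fun u => F (u, v, x))) ->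
  (forall u x, is_linmap (fun v => F (u, v, x))) ->
  (forall u v, is_linmap (fun x => F (u, v, x))) ->
  \sum_(p <- delta V f) \sum_(q <- delta Y p.1) F (q.1, q.2, p.2) =
  \sum_(p <- delta Y f) \sum_(q <- delta V p.2) F (p.1, q.1, q.2).
Proof. by move=> *; have := teq3_sum (F := F) (deltaA f); rewrite !big_allpairs_dep; apply. Qed.

Lemma psi_deltaS X Y Z (F : A * C Y Z * C X Y -> W) (f : C X Z) a :
  (forall v x, is_linmap (fun u => F (u, v, x))) ->
  (forall u x, is_linmap (fun v => F (u, v, x))) ->
  (forall u v, is_linmap (fun x => F (u, v, x))) ->
  \sum_(q <- psi f a) \sum_(r <- delta Y q.2) F (q.1, r.1, r.2) =
  \sum_(p <- delta Y f) \sum_(r <- psi p.2 a) \sum_(s <- psi p.1 r.1) F (s.1, s.2, r.2).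
Proof.
move=> *; have := teq3_sum (F := F) (psi_delta f a).
rewrite big_allpairs_dep big_flatten big_map => -> //.
by apply: eq_bigr => p _; rewrite big_allpairs_dep.
Qed.

Lemma psi_mulS X Z (F : A * C X Z -> W) (f : C X Z) a b :
  (forall v, is_linmap (fun u => F (u, v))) ->
  (forall u, is_linmap (fun v => F (u, v))) ->
  \sum_(p <- psi f (a * b)) F p =
  \sum_(q <- psi f a) \sum_(r <- psi q.2 b) F (q.1 * r.1, r.2).
Proof. by move=> *; rewrite (teq2_sum (psi_mul f a b)) // big_allpairs_dep. Qed.

Lemma psi_oneS X Z (F : A * C X Z -> W) (f : C X Z) :
  (forall v, is_linmap (fun u => F (u, v))) ->
  (forall u, is_linmap (fun v => F (u, v))) ->
  \sum_(p <- psi f 1) F p = F (1, f).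
Proof. by move=> *; rewrite (teq2_sum (psi_one f)) // big_seq1. Qed.

Lemma lin_eps (T : lmodType K) X (h : T -> C X X) (w : W) :
  is_linmap h -> is_linmap (fun x : T => eps (h x) *: w).
Proof. by move=> hl; apply: lin_coef => c x y; rewrite hl eps_lin. Qed.

End Sums.
Notation entwined := (entwined delta eps psi).
Notation comodule := (comodule delta eps).

(** A right [A]-module on a single space, to serve as coefficients of the cofree comodules. *)
Record is_amod (N : lmodType K) (act : N -> A -> N) : Prop := IsAmod {
  amod_lin1 : forall a, is_linmap (act^~ a);
  amod_lin2 : forall n, is_linmap (act n);
  amodM : forall n a b, act n (a * b) = act (act n a) b;
  amod1 : forall n, act n 1 = n }.

Lemma lin_amod1 (N T : lmodType K) act (h : T -> N) a :
  @is_amod N act -> is_linmap h -> is_linmap (fun x => act (h x) a).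
Proof. by move=> Hact; exact: (lin_comp (amod_lin1 Hact a)). Qed.

Lemma lin_amod2 (N T : lmodType K) act (h : T -> A) n :
  @is_amod N act -> is_linmap h -> is_linmap (fun x => act n (h x)).
Proof. by move=> Hact; exact: (lin_comp (amod_lin2 Hact n)). Qed.

Ltac lin_base := first
  [ apply: (lin_sum_to2 (@delta_lin _ _ _))
  | apply: (lin_sum_to2 (@psi_lin1 _ _ _))
  | apply: (lin_sum_to2 (@psi_lin2 _ _ _))
  | apply: lin_eps
  | match goal with
    | H : is_amod ?act |- is_linmap (fun x => ?act _ _) =>
        first [apply: (lin_amod1 _ H) | apply: (lin_amod2 _ H)]
    | H : forall X, is_linmap (?f X) |- is_linmap (fun x => ?f ?Y _) => apply: (lin_comp (H Y))
    | H : is_linmap ?f |- is_linmap (fun x => ?f _) => apply: (lin_comp H)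
    end ].

Ltac lin_hook ::= lin_base.

(** * Free and cofree entwined comodules *)

Section Cofree.
Variables (N : lmodType K) (act : N -> A -> N) (Hact : is_amod act) (Z : Ob).

Definition cofree_sp X := tens N (C X Z).
Definition cofree_rho X Y (t : cofree_sp X) : seq (cofree_sp Y * C X Y) :=
  [seq (tpure p.1 q.1, q.2) | p <- trep t, q <- delta Y p.2].
Definition cofree_act X (t : cofree_sp X) (a : A) : cofree_sp X :=
  \sum_(p <- trep t) \sum_(q <- psi p.2 a) tpure (act p.1 q.1) q.2.

(** Only the factor C(-,Z) coacts, so the axioms come down to coassociativity of [delta] and the
    counit law [eps_delta2]. *)
Lemma cofree_comodule : is_comodule delta eps cofree_rho.
Proof.
split=> [X Y|X Y Y' m|X m].
- apply: linear_to2P => W F Fl Fr; rewrite /cofree_rho; lin.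
- apply: teq3P => W F F1 F2 F3; rewrite /cofree_rho; norm.
  apply: eq_bigr => p _.
  by rewrite (deltaS (F := fun x => F (tpure p.1 x.1.1, x.1.2, x.2))); [|lin..].
- rewrite [RHS]tens_sum /cofree_rho; norm; apply: eq_bigr => p _.
  rewrite -[in RHS](eps_delta2 p.2) (linmap_sum (f := fun x => tpure p.1 x)); last by lin.
  apply: eq_bigr => q _.
  by rewrite pure_scaler.
Qed.

Definition cofree_com := Comodule cofree_comodule.

Lemma cofree_act_pure X n (f : C X Z) a :
  cofree_act (tpure n f) a = \sum_(q <- psi f a) tpure (act n q.1) q.2.
Proof. by rewrite /cofree_act; norml. Qed.

(** Each axiom of [psi] has its place: [psi_mulS] gives associativity of the action, [psi_oneS] its
    unit law, and [psi_deltaS] its compatibility with the coaction. *)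
Lemma cofree_entwined : is_entwined psi (M := cofree_com) cofree_act.
Proof.
split=> [X c m m' a|X c m a b|X m a b|X m|X Y m a].
- suff: is_linmap (fun m => @cofree_act X m a) by exact.
  by rewrite /cofree_act; lin.
- suff: is_linmap (@cofree_act X m) by exact.
  by rewrite /cofree_act; lin.
- rewrite /cofree_act; norm; apply: eq_bigr => p _.
  rewrite (psi_mulS (F := fun q => tpure (act p.1 q.1) q.2)); [|lin..].
  by apply: eq_bigr => q _; apply: eq_bigr => r _; rewrite (amodM Hact).
- rewrite [RHS]tens_sum; apply: eq_bigr => p _.
  rewrite (psi_oneS (F := fun q => tpure (act p.1 q.1) q.2)); [|lin..].
  by rewrite (amod1 Hact).
- apply: teq2P => W F Fl Fr; rewrite /= /cofree_rho {1}/cofree_act; norm.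
  apply: eq_bigr => p _.
  rewrite (psi_deltaS (F := fun x => F (tpure (act p.1 x.1.1) x.1.2, x.2))); [|lin..].
  apply: eq_bigr => d _; apply: eq_bigr => q _.
  by rewrite cofree_act_pure (linmap_sum (f := fun u => F (u, q.2))).
Qed.

Definition cofree := Entwined cofree_entwined.

End Cofree.

(** * The free entwined comodule M (x) A on a comodule M *)

Section ComoduleTheory.
Variable M : comodule.

Lemma rho_lin X Y : linear_to2 (@cm_rho _ _ _ _ _ M X Y).
Proof. by case: (cm_ax M). Qed.

Lemma rho_eps X (m : cm_sp M X) : \sum_(p <- cm_rho X m) eps p.2 *: p.1 = m.
Proof. by case: (cm_ax M). Qed.

Lemma rhoS (W : lmodType K) X Y Z (F : cm_sp M Y * C Z Y * C X Z -> W) (m : cm_sp M X) :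
  (forall v x, is_linmap (fun u => F (u, v, x))) ->
  (forall u x, is_linmap (fun v => F (u, v, x))) ->
  (forall u v, is_linmap (fun x => F (u, v, x))) ->
  \sum_(p <- cm_rho Z m) \sum_(q <- cm_rho Y p.1) F (q.1, q.2, p.2) =
  \sum_(p <- cm_rho Y m) \sum_(q <- delta Z p.2) F (p.1, q.1, q.2).
Proof.
case: (cm_ax M) => _ H _ *; have := teq3_sum (F := F) (H _ Y Z m).
by rewrite !big_allpairs_dep; apply.
Qed.

Ltac lin_hook ::= first [lin_base | apply: (lin_sum_to2 (@rho_lin _ _))].

Definition free_sp X := tens (cm_sp M X) A.
Definition free_rho X Y (t : free_sp X) : seq (free_sp Y * C X Y) :=
  flatten [seq [seq (tpure q.1 r.1, r.2) | q <- cm_rho Y p.1, r <- psi q.2 p.2]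
          | p <- trep t].
Definition free_act X (t : free_sp X) (a : A) : free_sp X :=
  \sum_(p <- trep t) tpure p.1 (p.2 * a).

(** Since [psi] carries m_1 past the factor [A], coassociativity combines that of M with
    [psi_deltaS], and the counit law combines that of M with [psi_eps]. *)
Lemma free_comodule : is_comodule delta eps free_rho.
Proof.
split=> [X Y|X Y Y' m|X m].
- apply: linear_to2P => W F Fl Fr; rewrite /free_rho; lin.
- apply: teq3P => W F F1 F2 F3; rewrite /free_rho; norm.
  apply: eq_bigr => p _.
  (* Moving the second coaction outside the first [psi] makes the two coactions adjacent, as [rhoS]
     requires. *)
  under eq_bigr do rewrite exchange_big /=.
  rewrite (rhoS (F := fun x => \sum_(s <- psi x.2 p.2) \sum_(r <- psi x.1.2 s.1)
                                F (tpure x.1.1 r.1, r.2, s.2))); [|lin..].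
  apply: eq_bigr => q _ /=.
  by rewrite (psi_deltaS (F := fun x => F (tpure q.1 x.1.1, x.1.2, x.2))); [|lin..].
- rewrite [RHS]tens_sum /free_rho; norm; apply: eq_bigr => p _.
  rewrite -[in RHS](rho_eps p.1) (linmap_sum (f := fun x => tpure x p.2)); last by lin.
  apply: eq_bigr => q _.
  (* The scalar eps(m_1) moves onto the factor [A], where [psi_eps] expands it. *)
  rewrite pure_scalel -pure_scaler -psi_eps (linmap_sum (f := tpure q.1)); last by lin.
  by apply: eq_bigr => r _; rewrite pure_scaler.
Qed.

Definition free_com := Comodule free_comodule.

Lemma free_act_pure X m b a : @free_act X (tpure m b) a = tpure m (b * a).
Proof. by rewrite /free_act; norml. Qed.

Lemma free_entwined : is_entwined psi (M := free_com) free_act.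
Proof.
split=> [X c m m' a|X c m a b|X m a b|X m|X Y m a].
- suff: is_linmap (fun m => @free_act X m a) by exact.
  by rewrite /free_act; lin.
- suff: is_linmap (@free_act X m) by exact.
  by rewrite /free_act; lin.
- by rewrite /free_act; norm; under eq_bigr do rewrite mulrA.
- by rewrite [RHS]tens_sum; apply: eq_bigr => p _; rewrite mulr1.
- apply: teq2P => W F Fl Fr; rewrite /= /free_rho {1}/free_act; norm.
  apply: eq_bigr => p _; apply: eq_bigr => q _.
  rewrite (psi_mulS (F := fun x => F (tpure q.1 x.1, x.2))); [|lin..].
  by apply: eq_bigr => r _; apply: eq_bigr => s _; rewrite free_act_pure.
Qed.

Definition free := Entwined free_entwined.

(** The unit of the adjunction, colinear because psi(f (x) 1) = 1 (x) f. It is in general not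
    [A]-linear; the retraction will be applied to it. *)
Lemma unit_comhom : @is_comhom _ _ _ _ _ M free_com (fun X m => tpure m 1).
Proof.
split=> [X|X Y m]; first by lin.
apply: teq2P => W F Fl Fr; rewrite /= /free_rho; norm.
apply: eq_bigr => q _.
by rewrite (psi_oneS (F := fun x => F (tpure q.1 x.1, x.2))); [|lin..].
Qed.

Definition unit_mor : comhom M free_com := exist _ _ unit_comhom.

End ComoduleTheory.

Ltac lin_hook ::= first [lin_base | apply: (lin_sum_to2 (@rho_lin _ _ _))].

Lemma comhom_comp (M N L : comodule) (f : forall X, cm_sp M X -> cm_sp N X)
    (g : forall X, cm_sp N X -> cm_sp L X) :
  is_comhom f -> is_comhom g -> is_comhom (M := M) (N := L) (fun X m => g X (f X m)).
Proof.
move=> [fl fr] [gl gr]; split=> [X|X Y m]; first exact: lin_comp.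
apply: teq2P => W F Fl Fr; rewrite (teq2_sum (gr X Y _)) // big_map.
rewrite (teq2_sum (fr X Y m)).
- by rewrite !big_map.
- by move=> v; apply: (lin_comp (f := fun u => F (u, v))) => //.
- by move=> u c x y; exact: Fr.
Qed.

Lemma comhom_id (M : comodule) : is_comhom (M := M) (N := M) (fun X m => m).
Proof. by split=> // X Y m; apply: teq2P => W F Fl Fr; norm; apply: eq_bigr => -[]. Qed.

(** Functoriality of M |-> M (x) A, which provides one side of the naturality square of [nu]. *)
Lemma free_mor_ecomhom (M N : comodule) (f : forall X, cm_sp M X -> cm_sp N X) :
  is_comhom f ->
  is_comhom (M := free_com M) (N := free_com N) (fun X => tmapl (f X)) /\
  (forall X (m : free_sp M X) a, tmapl (f X) (free_act m a) = free_act (tmapl (f X) m) a).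
Proof.
move=> [fl fr]; split=> [|X m a].
  split=> [X|X Y m]; first exact: tmapl_lin.
  apply: teq2P => W F Fl Fr; rewrite /= /free_rho sum_flatten.
  rewrite sum_tmapl; [|lin..].
  norm; apply: eq_bigr => p _.
  rewrite (teq2_sum (F := fun q => \sum_(r <- psi q.2 p.2) F (tpure q.1 r.1, r.2)) (fr X Y p.1));
    [|lin..].
  rewrite big_map; apply: eq_bigr => q _; apply: eq_bigr => r _ /=.
  by rewrite tmapl_pure.
rewrite /free_act sum_tmapl; [|lin..].
rewrite (linmap_sum (f := tmapl (f X))); last exact: tmapl_lin.
by apply: eq_bigr => p _; rewrite tmapl_pure.
Qed.

Definition free_mor (M N : comodule) (f : comhom M N) : ecomhom (free M) (free N) :=
  exist _ _ (free_mor_ecomhom (svalP f)).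

Lemma ec_act_amod (M : entwined) X : is_amod (@ec_act _ _ _ _ _ _ _ M X).
Proof. by case: M => M act [/= *]; split=> // ? c x y //=. Qed.

Lemma lin_ec_act1 (M : entwined) X (T : lmodType K) (h : T -> cm_sp (ec_com M) X) a :
  is_linmap h -> is_linmap (fun x => ec_act (h x) a).
Proof. exact: (lin_comp (amod_lin1 (ec_act_amod M X) a)). Qed.
Lemma lin_ec_act2 (M : entwined) X (T : lmodType K) (h : T -> A) (m : cm_sp (ec_com M) X) :
  is_linmap h -> is_linmap (fun x => ec_act m (h x)).
Proof. exact: (lin_comp (amod_lin2 (ec_act_amod M X) m)). Qed.

Ltac lin_hook ::= first
  [lin_base | apply: (lin_sum_to2 (@rho_lin _ _ _)) | apply: lin_ec_act1 | apply: lin_ec_act2].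

Lemma rho_act (M : entwined) X Y (m : cm_sp (ec_com M) X) a :
  teq2 (cm_rho Y (ec_act m a))
       [seq (ec_act p.1 q.1, q.2) | p <- cm_rho Y m, q <- psi p.2 a].
Proof. by case: M m => M act []. Qed.

(** * The counit and the coaction as entwined morphisms *)

Section EntwinedMorphisms.
Variable M : entwined.

(** The action map is colinear by the entwining condition [rho_act] and [A]-linear by associativity
    of the action. *)
Lemma counit_ecomhom :
  is_comhom (M := free_com (ec_com M)) (N := ec_com M)
    (fun X t => \sum_(p <- trep t) ec_act p.1 p.2) /\
  (forall X (t : free_sp (ec_com M) X) a,
     \sum_(p <- trep (free_act t a)) ec_act p.1 p.2 =
     ec_act (\sum_(p <- trep t) ec_act p.1 p.2) a).
Proof.
split=> [|X t a].
  split=> [X|X Y m]; first by lin.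
  apply: teq2P => W F Fl Fr; rewrite /= /free_rho.
  rewrite (linmap_sum (f := fun t => \sum_(p <- cm_rho Y t) F p)); last by lin.
  norm; apply: eq_bigr => p _.
  rewrite (teq2_sum (rho_act p.1 p.2)) // sum_flatten.
  apply: eq_bigr => q _; rewrite big_map; apply: eq_bigr => r _ /=.
  by rewrite sum_pure; [|lin..].
rewrite /free_act (linmap_sum (f := fun t => ec_act t a)); last by lin.
by norm; apply: eq_bigr => p _; rewrite (amodM (ec_act_amod M X)).
Qed.

Definition counit_mor : ecomhom (free (ec_com M)) M := exist _ _ counit_ecomhom.

(** Colinearity is coassociativity of the coaction, and [A]-linearity is the entwining condition.
    Through this morphism [nu] on M is compared with [nu] on a cofree comodule. *)
Lemma coact_ecomhom Z :
  is_comhom (M := ec_com M) (N := cofree_com (cm_sp (ec_com M) Z) Z)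
    (fun X m => \sum_(p <- cm_rho Z m) tpure p.1 p.2) /\
  (forall X (m : cm_sp (ec_com M) X) a,
     \sum_(p <- cm_rho Z (ec_act m a)) tpure p.1 p.2 =
     cofree_act (@ec_act _ _ _ _ _ _ _ M Z) (\sum_(p <- cm_rho Z m) tpure p.1 p.2) a).
Proof.
split=> [|X m a].
  split=> [X|X Y m]; first by lin.
  apply: teq2P => W F Fl Fr; rewrite /= /cofree_rho; norm.
  rewrite -(rhoS (F := fun x => F (tpure x.1.1 x.1.2, x.2))); [|lin..].
  by apply: eq_bigr => p _; rewrite (linmap_sum (f := fun u => F (u, p.2))).
rewrite /cofree_act; norm.
by rewrite (teq2_sum (rho_act m a)); [|lin..]; rewrite sum_flatten; norm.
Qed.

Definition coact_mor Z : ecomhom M (cofree (ec_act_amod M Z) Z) :=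
  exist _ _ (coact_ecomhom Z).

Lemma ecomhom_id : is_comhom (M := ec_com M) (N := ec_com M) (fun X m => m) /\
  (forall X (m : cm_sp (ec_com M) X) a, ec_act m a = ec_act m a).
Proof. by split; first exact: comhom_id. Qed.

Definition id_mor : ecomhom M M := exist _ _ ecomhom_id.

End EntwinedMorphisms.

(** Functoriality of N |-> N (x) C(-,Z), applied later to the map a |-> n a from [A] to N. *)
Lemma cofree_mor_ecomhom (N N' : lmodType K) (act : N -> A -> N) (act' : N' -> A -> N')
    (f : N -> N') Z :
  is_amod act' -> is_linmap f -> (forall n a, f (act n a) = act' (f n) a) ->
  is_comhom (M := cofree_com N Z) (N := cofree_com N' Z) (fun X => tmapl f) /\
  (forall X (t : cofree_sp N Z X) a,
     tmapl f (cofree_act act t a) = cofree_act act' (tmapl f t) a).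
Proof.
move=> Hact' fl fa; split=> [|X t a].
  split=> [X|X Y m]; first exact: tmapl_lin.
  apply: teq2P => W F Fl Fr; rewrite /= /cofree_rho sum_flatten.
  rewrite sum_tmapl; [|lin..].
  norm; apply: eq_bigr => p _; apply: eq_bigr => q _ /=.
  by rewrite tmapl_pure.
rewrite /cofree_act sum_tmapl; [|lin..].
rewrite (linmap_sum (f := tmapl f)); last exact: tmapl_lin.
apply: eq_bigr => p _; rewrite (linmap_sum (f := tmapl f)); last exact: tmapl_lin.
by apply: eq_bigr => q _; rewrite (tmapl_pure fl) fa.
Qed.

Definition cofree_mor (N N' : lmodType K) (act : N -> A -> N) (act' : N' -> A -> N')
    (Hact : is_amod act) (Hact' : is_amod act') (f : N -> N') Z
    (fl : is_linmap f) (fa : forall n a, f (act n a) = act' (f n) a) :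
    ecomhom (cofree Hact Z) (cofree Hact' Z) :=
  exist _ _ (cofree_mor_ecomhom Z Hact' fl fa).

Lemma reg_amod : is_amod (fun a b : A => a * b).
Proof.
split=> [a|a|a b c|a]; last exact: mulr1.
- exact: lin_mulr.
- exact: lin_mull.
- exact: mulrA.
Qed.

(** * From a natural retraction to W_1 *)

Section SplitMono.
Variable P : forall M N : entwined, comhom (ec_com M) (ec_com N) -> ecomhom M N.
Hypothesis PG : forall M N (phi : ecomhom M N) X m,
  sval (P (G_mor phi)) X m = sval phi X m.
Hypothesis Pnat : forall M M' N N' (al : ecomhom M' M) (be : ecomhom N N')
    (g : comhom (ec_com M) (ec_com N)) (g' : comhom (ec_com M') (ec_com N')),
  (forall X m, sval g' X m = sval be X (sval g X (sval al X m))) ->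
  forall X m, sval (P g') X m = sval be X (sval (P g) X (sval al X m)).

Definition nu (M : entwined) X (m : cm_sp (ec_com M) X) : tens (cm_sp (ec_com M) X) A :=
  sval (P (N := free (ec_com M)) (unit_mor (ec_com M))) X m.

Lemma nu_lin M X : is_linmap (@nu M X).
Proof. by case: (svalP (P (N := free (ec_com M)) (unit_mor (ec_com M)))) => -[]. Qed.

Lemma nu_rho M X Y (m : cm_sp (ec_com M) X) :
  teq2 (free_rho Y (nu m)) [seq (nu p.1, p.2) | p <- cm_rho Y m].
Proof. by case: (svalP (P (N := free (ec_com M)) (unit_mor (ec_com M)))) => -[_ H] _; exact: H. Qed.

Lemma nu_act M X (m : cm_sp (ec_com M) X) a : nu (ec_act m a) = free_act (nu m) a.
Proof. by case: (svalP (P (N := free (ec_com M)) (unit_mor (ec_com M)))) => _; exact. Qed.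

(** Both sides are [P] of the comodule map m |-> phi(m) (x) 1, factored once as phi followed by the
    unit and once as the unit followed by phi (x) A. *)
Lemma nu_nat (M M' : entwined) (phi : ecomhom M M') X (m : cm_sp (ec_com M) X) :
  nu (sval phi X m) = tmapl (sval phi X) (nu m).
Proof.
pose g' : comhom (ec_com M) (ec_com (free (ec_com M'))) :=
  exist _ _ (comhom_comp (proj1 (svalP phi)) (unit_comhom (ec_com M'))).
have E1 : sval (P (M := M) (N := free (ec_com M')) g') X m = nu (sval phi X m).
  exact: (Pnat (al := phi) (be := id_mor (free (ec_com M'))) (g := unit_mor (ec_com M'))).
rewrite -E1.
apply: (Pnat (al := id_mor M) (be := free_mor (G_mor phi)) (g := unit_mor (ec_com M))).
by move=> Y n /=; rewrite tmapl_pure //; case: phi {g' E1} => f [[]].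
Qed.

(** The counit after the unit is the identity, an entwined morphism, so [PG] says that [P] fixes it.
    By naturality [P] also sends it to the counit after [nu]. *)
Lemma nu_split (M : entwined) X (m : cm_sp (ec_com M) X) :
  \sum_(p <- trep (nu m)) ec_act p.1 p.2 = m.
Proof.
apply: etrans (PG (id_mor M) m).
symmetry; apply: (Pnat (al := id_mor M) (be := counit_mor M) (g := unit_mor (ec_com M))).
move=> Y n /=; rewrite sum_pure; [|lin..].
by rewrite (amod1 (ec_act_amod M Y)).
Qed.

Notation E Z := (cofree reg_amod Z).

(** Since [in_W1] speaks of lists, representatives of the two nested tensors are flattened into
    one. *)
Definition lam Z (f : C Z Z) : seq (A * A) :=
  flatten [seq [seq (eps q.2 *: q.1, p.2) | q <- trep p.1]
          | p <- trep (@nu (E Z) Z (tpure 1 f))].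

Ltac lin_hook ::= first
  [lin_base | apply: (lin_sum_to2 (@rho_lin _ _ _)) | apply: lin_ec_act1 | apply: lin_ec_act2
  | match goal with
    | |- is_linmap (fun x => @nu ?M ?X _) => apply: (lin_comp (@nu_lin M X))
    end].

Lemma lam_lin Z : linear_to2 (@lam Z).
Proof. by apply: linear_to2P => W F Fl Fr; rewrite /lam; lin. Qed.

Ltac lin_hook ::= first
  [lin_base | apply: (lin_sum_to2 (@rho_lin _ _ _)) | apply: lin_ec_act1 | apply: lin_ec_act2
  | apply: (lin_sum_to2 (@lam_lin _))
  | match goal with
    | |- is_linmap (fun x => @nu ?M ?X _) => apply: (lin_comp (@nu_lin M X))
    end].

(** The map a |-> n a induces an entwined morphism from [E Z] to N (x) C(-,Z) taking 1 (x) g to n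
    (x) g, and [nu_nat] transports the definition of [lam] along it. *)
Lemma nu_cofree (N W : lmodType K) (act : N -> A -> N) (Hact : is_amod act) Z
    (F : N * A -> W) n (g : C Z Z) :
  (forall v, is_linmap (fun u => F (u, v))) ->
  (forall u, is_linmap (fun v => F (u, v))) ->
  \sum_(p <- trep (@nu (cofree Hact Z) Z (tpure n g)))
     \sum_(q <- trep p.1) F (eps q.2 *: q.1, p.2) =
  \sum_(l <- lam g) F (act n l.1, l.2).
Proof.
move=> Fl Fr; pose phi := cofree_mor reg_amod Hact Z (amod_lin2 Hact n) (amodM Hact n).
have -> : tpure n g = sval phi Z (tpure 1 g).
  by rewrite /= tmapl_pure ?(amod1 Hact) //; exact: (amod_lin2 Hact n).
rewrite nu_nat /= sum_tmapl; [|lin..]; rewrite /lam; norm.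
apply: eq_bigr => p _; apply: eq_bigr => q _.
by rewrite (linmap_scale _ _ (amod_lin2 Hact n)).
Qed.

(* Naturality of [nu] along the coaction, followed by the counit of [C]. *)
Lemma sum_nu (M : entwined) (W : lmodType K) X (m : cm_sp (ec_com M) X)
    (F : cm_sp (ec_com M) X * A -> W) :
  (forall v, is_linmap (fun u => F (u, v))) ->
  (forall u, is_linmap (fun v => F (u, v))) ->
  \sum_(p <- trep (nu m)) F p =
  \sum_(r <- cm_rho X m) \sum_(l <- lam r.2) F (ec_act r.1 l.1, l.2).
Proof.
move=> Fl Fr; pose Phi (t : tens (tens (cm_sp (ec_com M) X) (C X X)) A) :=
  \sum_(p <- trep t) \sum_(q <- trep p.1) F (eps q.2 *: q.1, p.2).
have Phil : is_linmap Phi by rewrite /Phi; lin.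
transitivity (Phi (nu (sval (coact_mor M X) X m))).
  rewrite nu_nat /Phi sum_tmapl; [|lin..].
  norm; apply: eq_bigr => -[u v] _ /=.
  rewrite -[in LHS](rho_eps u) (linmap_sum (f := fun u => F (u, v))) //.
  by symmetry; norml.
rewrite /= (linmap_sum (f := @nu (cofree (ec_act_amod M X) X) X)); last exact: nu_lin.
rewrite (linmap_sum _ _ Phil); apply: eq_bigr => r _.
exact: nu_cofree.
Qed.

(** Apply id (x) eps to [nu_split] at 1 (x) f. The action on [E X] introduces a [psi], which
    [psi_eps] removes, leaving the product of the two legs of [lam]. *)
Lemma lam_mul X (f : C X X) : \sum_(q <- lam f) q.1 * q.2 = (eps f)%:A.
Proof.
pose Phi (t : tens A (C X X)) : A := \sum_(q <- trep t) eps q.2 *: q.1.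
have Phil : is_linmap Phi by rewrite /Phi; lin.
transitivity (Phi (tpure 1 f)); last by rewrite /Phi sum_pure; [|lin..].
rewrite -[in RHS](nu_split (M := E X) (tpure 1 f)) (linmap_sum _ _ Phil) /lam; norm.
apply: eq_bigr => p _; rewrite /= /cofree_act /Phi; norm.
apply: eq_bigr => q _; rewrite -scalerAl scalerAr -psi_eps mulr_sumr.
by apply: eq_bigr => r _; rewrite scalerAr.
Qed.

(** Compute [nu] at (1 (x) g)a twice: [A]-linearity multiplies the last leg by a, while expanding (1
    (x) g)a by [psi] and using [nu_cofree] multiplies the first leg. *)
Lemma lam_act Z (g : C Z Z) a :
  teq2 [seq (q.1, q.2 * a) | q <- lam g] [seq (r.1 * q.1, q.2) | r <- psi g a, q <- lam r.2].
Proof.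
apply: teq2P => W F Fl Fr; rewrite big_map [RHS]sum_flatten.
pose Phi (t : tens (tens A (C Z Z)) A) :=
  \sum_(p <- trep t) \sum_(q <- trep p.1) F (eps q.2 *: q.1, p.2).
have Phil : is_linmap Phi by rewrite /Phi; lin.
transitivity (Phi (@nu (E Z) Z (@ec_act _ _ _ _ _ _ _ (E Z) Z (tpure 1 g) a))).
  by rewrite nu_act /Phi /free_act /lam; norm.
rewrite /= (cofree_act_pure reg_amod) (linmap_sum (f := @nu (E Z) Z)); last exact: nu_lin.
rewrite (linmap_sum _ _ Phil); apply: eq_bigr => r _.
rewrite big_map mul1r; exact: (nu_cofree reg_amod).
Qed.

(** Colinearity of [nu] at 1 (x) f in A (x) C(X,Y), read after applying [eps] to the middle factor
    C(Y,Y). *)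
Lemma lam_psi X Y (f : C X Y) :
  teq3 [seq (q.1, q.2, p.2) | p <- delta Y f, q <- lam p.1]
       (flatten [seq flatten [seq [seq (r.1, s.1, s.2) | r <- psi p.1 q.1, s <- psi r.2 q.2]
                             | q <- lam p.2]
                | p <- delta X f]).
Proof.
apply: teq3P => W F F1 F2 F3.
(* [G] is the test map [F] precomposed with this evaluation of [eps]. *)
pose G (x : tens (tens A (C Y Y)) A * C X Y) :=
  \sum_(p <- trep x.1) \sum_(q <- trep p.1) F (eps q.2 *: q.1, p.2, x.2).
transitivity (\sum_(x <- free_rho Y (@nu (E Y) X (tpure 1 f))) G x).
  rewrite (teq2_sum (nu_rho _)); [|rewrite /G; lin..].
  by rewrite big_map /= /cofree_rho /G /lam; norm.
(* In the coaction of M (x) A, [eps] cancels against the [delta] of the cofree coaction by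
   [eps_delta1]. Only the [psi] past the last factor [A] survives. *)
pose H (p : tens A (C X Y) * A) :=
  \sum_(t <- trep p.1) \sum_(r <- psi t.2 p.2) F (t.1, r.1, r.2).
transitivity (\sum_(p <- trep (@nu (E Y) X (tpure 1 f))) H p).
  rewrite /free_rho /= /cofree_rho /G /=; norml.
  apply: eq_bigr => p _; apply: eq_bigr => t _; symmetry.
  pose psiF c := \sum_(r <- psi c p.2) F (t.1, r.1, r.2).
  have psiFl : is_linmap psiF by rewrite /psiF; lin.
  rewrite -/(psiF t.2) -[t.2 in LHS](eps_delta1 t.2) (linmap_sum _ _ psiFl).
  apply: eq_bigr => d _; rewrite (linmap_scale _ _ psiFl) /psiF scaler_sumr.
  by apply: eq_bigr => r _; rewrite -(linmap_scale (f := fun u => F (u, r.1, r.2))).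
(* The remaining [nu] is written through [lam]; the action on 1 (x) f_1 in [sum_nu] supplies the
   other [psi]. *)
rewrite (sum_nu (M := E Y) (tpure 1 f)); [|rewrite /H; lin..].
rewrite /= /cofree_rho /cofree_act /H; norm.
by apply: eq_bigr => d _; apply: eq_bigr => l _; apply: eq_bigr => s _; rewrite mul1r.
Qed.

End SplitMono.

Lemma separable_W1 : G_separable delta eps psi ->
  exists lam : forall X : Ob, C X X -> seq (A * A),
    in_W1 delta psi lam /\
    (forall (X : Ob) (f : C X X), \sum_(q <- lam X f) q.1 * q.2 = (eps f)%:A).
Proof.
move=> [P [PG Pnat]]; exists (@lam P); split; last exact: lam_mul.
split; [exact: lam_lin | exact: lam_psi | exact: lam_act].
Qed.

(** * From W_1 to a natural retraction *)

Section Averaging.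
Variable lam : forall X : Ob, C X X -> seq (A * A).
Hypothesis lamW : in_W1 delta psi lam.

Definition avg (M N : entwined) (g : forall X, cm_sp (ec_com M) X -> cm_sp (ec_com N) X)
    X (m : cm_sp (ec_com M) X) : cm_sp (ec_com N) X :=
  \sum_(p <- cm_rho X m) \sum_(l <- lam p.2) ec_act (g X (ec_act p.1 l.1)) l.2.

Let lamL X : linear_to2 (@lam X). Proof. by case: lamW. Qed.

Ltac lin_hook ::= first
  [lin_base | apply: (lin_sum_to2 (@rho_lin _ _ _)) | apply: lin_ec_act1 | apply: lin_ec_act2
  | apply: (lin_sum_to2 (@lamL _))].

(** The first condition of W_1, between two uses of coassociativity, gives colinearity; the second
    gives [A]-linearity. *)
Lemma avg_ecomhom (M N : entwined) (g : forall X, cm_sp (ec_com M) X -> cm_sp (ec_com N) X) :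
  is_comhom g ->
  is_comhom (avg g) /\ (forall X m a, @avg _ _ g X (ec_act m a) = ec_act (avg g m) a).
Proof.
move=> [gl gr]; case: lamW => _ lampsi lamact; split=> [|X m a].
  split=> [X|X Y m]; first by rewrite /avg; lin.
  apply: teq2P => W F Fl Fr.
  rewrite {1}/avg (linmap_sum (f := fun n => \sum_(p <- cm_rho Y n) F p)); last by lin.
  rewrite big_map /avg.
  (* Coacting on the average passes through both actions by [rho_act] and through [g] by [gr]. [Phi]
     collects the result, with [lam] and the two [psi] arranged as on the right of the first W_1
     condition. *)
  pose Phi (x : cm_sp (ec_com M) Y * C X Y * C X X) :=
    \sum_(l <- lam x.2) \sum_(r <- psi x.1.2 l.1) \sum_(s <- psi r.2 l.2)
      F (ec_act (g Y (ec_act x.1.1 r.1)) s.1, s.2).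
  transitivity (\sum_(p <- cm_rho X m) \sum_(q <- cm_rho Y p.1) Phi (q.1, q.2, p.2)).
    apply: eq_bigr => p _; rewrite /Phi /= exchange_big /=.
    rewrite (linmap_sum (f := fun n => \sum_(p <- cm_rho Y n) F p)); last by lin.
    apply: eq_bigr => l _; rewrite (teq2_sum (rho_act _ _)) // sum_flatten.
    rewrite (teq2_sum (gr X Y _)); [|lin..].
    by rewrite big_map (teq2_sum (rho_act _ _)); [norm|lin..].
  rewrite (rhoS (F := Phi)); [|rewrite /Phi; lin..].
  pose Psi n (x : A * A * C X Y) := F (ec_act (g Y (ec_act n x.1.1)) x.1.2, x.2).
  transitivity (\sum_(p <- cm_rho Y m) \sum_(d <- delta Y p.2) \sum_(l <- lam d.1)
                  Psi p.1 (l.1, l.2, d.2)).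
    apply: eq_bigr => p _; have := teq3_sum (F := Psi p.1) (lampsi _ _ p.2).
    rewrite sum_flatten => E; etransitivity; last first.
      apply: etrans (esym (E _ _ _)) _; [rewrite /Psi; lin..|].
      by apply: eq_bigr => d _; rewrite big_map.
    by rewrite /Phi /Psi; norm.
  (* Coassociativity is now read backwards at the object Y, so that the inner sum becomes the
     average of m_0. *)
  rewrite -(rhoS (F := fun x => \sum_(l <- lam x.1.2) Psi x.1.1 (l.1, l.2, x.2)));
    [|rewrite /Psi; lin..].
  apply: eq_bigr => p _ /=; rewrite (linmap_sum (f := fun u => F (u, p.2))) //.
  by apply: eq_bigr => q _; rewrite (linmap_sum (f := fun u => F (u, p.2))).
rewrite /avg (teq2_sum (rho_act m a)); [|lin..].
rewrite sum_flatten (linmap_sum (f := fun n => ec_act n a)); last by lin.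
apply: eq_bigr => p _; rewrite (linmap_sum (f := fun n => ec_act n a)); last by lin.
rewrite big_map /=.
(* The second W_1 condition trades a_psi on the first leg of [lam] for a on the second. *)
have := teq2_sum (F := fun l => ec_act (g X (ec_act p.1 l.1)) l.2) (lamact _ p.2 a).
rewrite big_map sum_flatten => E.
transitivity (\sum_(i <- psi p.2 a)
  \sum_(l <- [seq (i.1 * q.1, q.2) | q <- lam i.2]) ec_act (g X (ec_act p.1 l.1)) l.2).
  apply: eq_bigr => r _; rewrite big_map; apply: eq_bigr => l _.
  by rewrite (amodM (ec_act_amod M X)).
rewrite -E; [|lin..].
by apply: eq_bigr => l _; rewrite (amodM (ec_act_amod N X)).
Qed.

Definition avg_mor (M N : entwined) (g : comhom (ec_com M) (ec_com N)) : ecomhom M N :=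
  exist _ _ (avg_ecomhom (svalP g)).

(** Colinearity of [al] moves it through the coaction, and [A]-linearity of [al] and [be] moves them
    through the two actions. *)
Lemma avg_mor_nat (M M' N N' : entwined) (al : ecomhom M' M) (be : ecomhom N N')
    (g : comhom (ec_com M) (ec_com N)) (g' : comhom (ec_com M') (ec_com N')) :
  (forall X m, sval g' X m = sval be X (sval g X (sval al X m))) ->
  forall X m, sval (avg_mor g') X m = sval be X (sval (avg_mor g) X (sval al X m)).
Proof.
move: al be g g' => [al [[all alr] ala]] [be [[bel ber] bea]] [g [gl gr]] [g' gc'] /= E X m.
rewrite /avg (linmap_sum _ _ (bel X)) (teq2_sum (alr X X m)).
- rewrite big_map; apply: eq_bigr => p _ /=.
  rewrite (linmap_sum _ _ (bel X)); apply: eq_bigr => l _.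
  by rewrite bea E ala.
- by move=> v; apply: (lin_comp (f := be X)) => //; lin.
- by move=> u; apply: (lin_comp (f := be X)) => //; lin.
Qed.

Lemma avg_mor_G (M N : entwined) (phi : ecomhom M N) X m :
  (forall (X : Ob) (f : C X X), \sum_(q <- lam f) q.1 * q.2 = (eps f)%:A) ->
  sval (avg_mor (G_mor phi)) X m = sval phi X m.
Proof.
case: phi => phi [[phil phir] phia] /= lam1.
rewrite -[in RHS](rho_eps m) (linmap_sum _ _ (phil X)); apply: eq_bigr => p _.
(* Acting by an inserted 1 turns the scalar eps(m_1) into the action of eps(m_1)1, which [lam1]
   replaces by the product of the legs of [lam]. *)
rewrite -[p.1 in RHS](amod1 (ec_act_amod M X)).
rewrite -(linmap_scale _ _ (amod_lin2 (ec_act_amod M X) p.1)) -lam1.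
rewrite (linmap_sum _ _ (amod_lin2 (ec_act_amod M X) p.1)) (linmap_sum _ _ (phil X)).
by apply: eq_bigr => l _; rewrite -phia (amodM (ec_act_amod M X)).
Qed.

End Averaging.

End Setup.

Theorem theorem4p11 (K : fieldType) (Ob : Type) (C : Ob -> Ob -> lmodType K)
  (delta : forall X Y Z : Ob, C X Z -> seq (C Y Z * C X Y))
  (eps : forall X : Ob, C X X -> K)
  (HC : is_coalgebra_so delta eps)
  (A : algType K) (psi : forall X Y : Ob, C X Y -> A -> seq (A * C X Y))
  (Hpsi : is_entwining delta eps psi) :
  G_separable delta eps psi <->
  exists lam : forall X : Ob, C X X -> seq (A * A),
    in_W1 delta psi lam /\
    (forall (X : Ob) (f : C X X), \sum_(q <- lam X f) q.1 * q.2 = (eps X f)%:A).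
Proof.
split=> [|[lam [lamW lam1]]]; first exact: (separable_W1 HC Hpsi).
exists (avg_mor Hpsi lamW); split=> [M N phi X m|M M' N N' al be g g' E X m].
- exact: avg_mor_G.
- exact: avg_mor_nat.
Qed.
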